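(* Let $A \in \mathbb{C}^{d\times d}$, $\phi \in \mathbb{C}^d$ and $L \in \mathbb{N}$ be such that $\{A^\ell \phi\}_{\ell=0}^{L-1}$ is a full-spark frame for $\mathbb{C}^d$, and let $\alpha_1, \alpha_2 \in \mathbb{R}$ satisfy $\alpha_1 - \alpha_2 \notin \pi\mathbb{Z}$. If $L \ge \frac{d^2}{4} + \frac{d}{2}$, then every $x \in \mathbb{C}^d$ can be recovered up to global phase from the samples $$\bigl\{ |\langle x, A^\ell \phi \rangle| \bigr\}_{\ell=0}^{L-1} \cup \bigl\{ |\langle x, A^\ell (\phi + e^{\mathrm{i}\alpha_k} A\phi) \rangle| \bigr\}_{\ell=0,\,k=1}^{L-2,\,2}.$$
   Context: A finite family of vectors is a frame for $\mathbb{C}^d$ if it spans $\mathbb{C}^d$. A frame $\{f_k\}_{k=0}^{L-1}$ for $\mathbb{C}^d$ (an indexed family, $L\ge d$) has full spark, i.e. is a full-spark frame, if every subfamily of $d$ elements (with distinct indices) spans $\mathbb{C}^d$. $\langle\cdot,\cdot\rangle$ is the standard Hermitian inner product on $\mathbb{C}^d$, linear in the first argument. The samples are indexed families: the values $|\langle x, A^\ell \phi\rangle|$ for each $\ell \in \{0,\dots,L-1\}$ and $|\langle x, A^\ell(\phi + e^{\mathrm{i}\alpha_k}A\phi)\rangle|$ for each $\ell\in\{0,\dots,L-2\}$ and $k\in\{1,2\}$ are known together with their indices; $A$, $\phi$, $\alpha_1$, $\alpha_2$ are known. A vector $x$ ''can be recovered up to global phase'' from the samples if every $y \in \mathbb{C}^d$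 having the same samples as $x$ is of the form $y = e^{\mathrm{i}\theta}x$ for some $\theta\in\mathbb{R}$. *)

(* Defs.v *)
From HB Require Import structures.
From mathcomp Require Import all_boot all_order all_algebra.
From mathcomp Require Import complex.
From mathcomp Require Import reals trigo.

Set Implicit Arguments.
Unset Strict Implicit.
Unset Printing Implicit Defensive.

Import Order.TTheory GRing.Theory Num.Theory.

Local Open Scope ring_scope.
Local Open Scope complex_scope.

Section PhaseRetrieval.
Variable R : realType.
Local Notation C := R[i].

Definition expi (theta : R) : C := cos theta +i* sin theta.

(* The library's [dotmx] takes row vectors; it is linear in its first argument
   and conjugate-linear in the second. *)
Definition inner (d : nat) (x y : 'cV[C]_d) : C := dotmx x^T y^T.

Definition is_frame (I : finType) (d : nat) (f : I -> 'cV[C]_d) : Prop :=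
  <<[seq f i | i : I]>>%VS = fullv.

(* Subfamilies are selected by sets of indices, so repeated vectors at
   distinct indices are allowed a priori. The inequality [d <= #|I|] is not
   listed: it follows from [is_frame f]. *)
Definition full_spark (I : finType) (d : nat) (f : I -> 'cV[C]_d) : Prop :=
  is_frame f /\
  forall S : {set I}, #|S| = d -> <<[seq f i | i in S]>>%VS = fullv.

Definition orbit_family (d : nat) (A : 'M[C]_d) (phi : 'cV[C]_d) (L : nat) :
  'I_L -> 'cV[C]_d := fun l => A ^+ l *m phi.

Definition orbit_samples (d : nat) (A : 'M[C]_d) (phi : 'cV[C]_d) (L : nat)
    (x : 'cV[C]_d) : {ffun 'I_L -> C} :=
  [ffun l : 'I_L => `|inner x (A ^+ l *m phi)|].

(* [`|z|] is the modulus of [z], as an element of [C]. The index [l] ranges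
   over 0, ..., L - 2. *)
Definition interference_samples (d : nat) (A : 'M[C]_d) (phi : 'cV[C]_d)
    (L : nat) (alpha : R) (x : 'cV[C]_d) : {ffun 'I_L.-1 -> C} :=
  [ffun l : 'I_L.-1 => `|inner x (A ^+ l *m (phi + expi alpha *: (A *m phi)))|].

Definition samples (d : nat) (A : 'M[C]_d) (phi : 'cV[C]_d) (L : nat)
    (alpha1 alpha2 : R) (x : 'cV[C]_d) :
    {ffun 'I_L -> C} * {ffun 'I_L.-1 -> C} * {ffun 'I_L.-1 -> C} :=
  (orbit_samples A phi L x,
   interference_samples A phi L alpha1 x,
   interference_samples A phi L alpha2 x).

Definition recoverable_up_to_phase (T : Type) (d : nat)
    (meas : 'cV[C]_d -> T) (x : 'cV[C]_d) : Prop :=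
  forall y : 'cV[C]_d, meas y = meas x ->
    exists theta : R, y = expi theta *: x.

End PhaseRetrieval.

Arguments orbit_family {R d} A phi L l.

(* Main.v *)
Require Import Defs.
From mathcomp Require Import all_boot all_order all_algebra.
From mathcomp Require Import complex.
From mathcomp Require Import reals trigo.
From mathcomp Require Import ring lra zify.

(** Write [a l] and [b l] for the inner products of [x] and [y] with
    [A ^+ l *m phi], and suppose that [x] and [y] have the same samples.

    The samples give [`|b l| = `|a l|], and the two interference samples give,
    by polarization, the products of consecutive coefficients (one of them
    conjugated): the real parts of [a l * (a l.+1)^*] after rotation by two
    angles that differ modulo [pi] determine this complex number
    ([polarization2], [samples_product]). So [y] has the coefficients of [x]
    up to one phase [c] along every run of consecutive indices at which the
    coefficients of [x] do not vanish ([phase_propagation]); where [a l = 0],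
    also [b l = 0].

    Let [z] be the number of indices [l] with [a l = 0]. If [d <= z], full
    spark forces [x = y = 0] ([full_spark_orthogonal]). Otherwise the bound on
    [L] gives [(z + 1) * (d - z) <= L], by the inequality between arithmetic
    and geometric means and the integrality of [L] ([block_bound]). Among
    [z + 1] disjoint blocks of [d - z] consecutive indices, one avoids the [z]
    zeros ([run_without]). For the phase [c] of this block, [y - c *: x] is
    orthogonal to the [d - z] frame vectors of the block and to the [z] vectors
    at the zeros, so it is [0] by full spark. *)

Set Implicit Arguments.
Unset Strict Implicit.

Import Order.TTheory GRing.Theory Num.Theory.
Local Open Scope ring_scope.

(** * Counting *)

(** Pigeonhole: fewer than [m] points cannot meet each of [m] consecutive
    blocks of length [n]. *)
Lemma run_without (p : pred nat) (n m s : nat) :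
  (count p (iota s (m * n)) < m)%N ->
  exists2 t, (s <= t)%N && (t + n <= s + m * n)%N & ~~ has p (iota t n).
Proof.
elim: m s => // m IHm s; rewrite mulSn iotaD count_cat => lt_count.
have [has_p | no_p] := boolP (has p (iota s n)); last by exists s => //; lia.
have [|t /andP[le_st le_t] no_p] := IHm (s + n)%N.
  by move: has_p; rewrite has_count; lia.
by exists t => //; lia.
Qed.

Lemma card_ord_count (q : pred nat) (L : nat) :
  #|[set i : 'I_L | q i]| = count q (iota 0 L).
Proof.
have -> : iota 0 L = index_iota 0 L by rewrite /index_iota subn0.
by rewrite cardsE -sum1_card -sum1_count big_mkord.
Qed.

(** When [p] fails on a run of length [n], adding the run to [p] raises the
    count by [n]. *)
Lemma count_add_run (p : pred nat) (L t n : nat) :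
  (t + n <= L)%N -> ~~ has p (iota t n) ->
  (count p (iota 0 L) + n <=
   count (fun l => p l || (t <= l < t + n)%N) (iota 0 L))%N.
Proof.
move=> le_tn; rewrite has_count -leqNgt leqn0 => /eqP no_p.
have -> : L = (t + (n + (L - (t + n))))%N by lia.
set q := fun l => _; rewrite !iotaD !count_cat add0n no_p.
have -> : count q (iota t n) = n.
  transitivity (size (iota t n)); last by rewrite size_iota.
  apply/eqP; rewrite -all_count; apply/allP => l; rewrite mem_iota /q => ->.
  exact: orbT.
have le_pq s : (count p s <= count q s)%N.
  by apply: sub_count => l pl; rewrite /q pl.
have := le_pq (iota 0 t); have := le_pq (iota (t + n) (L - (t + n))); lia.
Qed.

(** As [4 * (z + 1) * (d - z) <= (d + 1) ^ 2 <= 4 * L + 1], the integer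
    [(z + 1) * (d - z)] is at most [L]. *)
Lemma block_bound (R : realType) (d L z : nat) :
  (d%:R ^+ 2 / 4 + d%:R / 2 : R) <= L%:R -> (z.+1 * (d - z) <= L)%N.
Proof.
move=> le_dL; have : (d ^ 2 + 2 * d <= 4 * L)%N.
  by rewrite -(ler_nat R) natrD natrX !natrM; lra.
have [/eqP -> | /ltnW /subnK <-] := leqP d z; first by rewrite muln0.
rewrite addnK; move: (d - z)%N => n {le_dL d}.
rewrite -mulnn => le_nL.
have : (4 * (n * z.+1) <= (n + z.+1) * (n + z.+1))%N.
  by rewrite mulnn nat_AGM2.
nia.
Qed.

(** * Phases and polarization *)

Lemma sin_eq0_pi (R : realType) (t : R) :
  sin t = 0 -> exists m : int, t = m%:~R * pi.
Proof.
have sin_nat n : sin (n%:R * pi) = 0 :> R.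
  elim: n => [|n IHn]; first by rewrite mul0r sin0.
  by rewrite -natr1 mulrDl mul1r sinDpi IHn oppr0.
have sin_int m : sin (m%:~R * pi) = 0 :> R.
  by case: m => n; rewrite ?NegzE ?mulrNz ?mulNr ?sinN sin_nat ?oppr0.
move=> sin_t; exists (Num.floor (t / pi)).
set m := Num.floor _; have pi_pos := pi_gt0 R.
have sin_rest : sin (t - m%:~R * pi) = 0.
  by rewrite sinB sin_t sin_int mul0r mulr0 subrr.
have /andP[le_m lt_m] := floor_itv (t / pi).
have rest_ge0 : 0 <= t - m%:~R * pi by rewrite subr_ge0 -ler_pdivlMr.
have rest_lt : t - m%:~R * pi < pi.
  by move: lt_m; rewrite ltr_pdivrMr // intrD; lra.
have [/subr0_eq // | rest_neq0] := eqVneq (t - m%:~R * pi) 0.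
suff: 0 < sin (t - m%:~R * pi) by rewrite sin_rest ltxx.
by rewrite sin_gt0_pi // rest_lt lt_def rest_neq0 rest_ge0.
Qed.

Lemma expi_surj (R : realType) (c : R[i]) : `|c| = 1 -> exists t, c = expi t.
Proof.
case: c => a b /(congr1 (fun z => z ^+ 2)).
rewrite -add_Re2_Im2 expr1n /= => /complexI ab1.
have a_itv : -1 <= a <= 1 by nra.
have cos_a : cos (acos a) = a by rewrite acosK // in_itv.
have sin_a : sin (acos a) = `|b|.
  by rewrite sin_acos // -sqrtr_sqr -ab1; congr Num.sqrt; ring.
have [b_ge0 | b_lt0] := ger0P b.
  by exists (acos a); rewrite /expi cos_a sin_a ger0_norm.
by exists (- acos a); rewrite /expi cosN sinN cos_a sin_a ltr0_norm // opprK.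
Qed.

Lemma eq_norm_sqr_coord (R : realType) (a b : R[i]) :
  `|a| = `|b| ->
  complex.Re a ^+ 2 + complex.Im a ^+ 2 = complex.Re b ^+ 2 + complex.Im b ^+ 2.
Proof.
by move/(congr1 (fun z => z ^+ 2)); rewrite -!add_Re2_Im2 => /complexI.
Qed.

(** Expanding the squared moduli, the data determine the real part of
    [expi alpha * w], where [w] is [a] times the conjugate of [b], for [alpha]
    equal to [alpha1] and to [alpha2]. These are two real linear equations in
    the real and imaginary parts of [w], with determinant
    [sin (alpha1 - alpha2)] up to sign. *)
Lemma polarization2 (R : realType) (alpha1 alpha2 : R) (a b a' b' : R[i]) :
  ~ (exists m : int, alpha1 - alpha2 = m%:~R * pi) ->
  `|a| = `|a'| -> `|b| = `|b'| ->
  `|a + (expi alpha1)^*%C * b| = `|a' + (expi alpha1)^*%C * b'| ->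
  `|a + (expi alpha2)^*%C * b| = `|a' + (expi alpha2)^*%C * b'| ->
  a * b^*%C = a' * b'^*%C.
Proof.
move=> nalpha; case: a b a' b' => [a1 a2] [b1 b2] [a1' a2'] [b1' b2'].
move=> /eq_norm_sqr_coord/= eq_a /eq_norm_sqr_coord/= eq_b.
move=> /eq_norm_sqr_coord/= eq1 /eq_norm_sqr_coord/= eq2.
have := cos2Dsin2 alpha1; have := cos2Dsin2 alpha2.
have: sin (alpha1 - alpha2) != 0 by apply/eqP => /sin_eq0_pi.
rewrite sinB; move: eq1 eq2.
move: (cos alpha1) (sin alpha1) (cos alpha2) (sin alpha2).
move=> c1 s1 c2 s2 eq1 eq2 det_neq0 unit2 unit1.
(* [P +i* Q] is the difference of the two sides. *)
set P := (a1 * b1 + a2 * b2) - (a1' * b1' + a2' * b2').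
set Q := (a2 * b1 - a1 * b2) - (a2' * b1' - a1' * b2').
have lin1 : c1 * P - s1 * Q = 0 by rewrite /P /Q; nra.
have lin2 : c2 * P - s2 * Q = 0 by rewrite /P /Q; nra.
have P0 : P = 0.
  apply: (mulfI det_neq0); rewrite mulr0.
  transitivity (s1 * (c2 * P - s2 * Q) - s2 * (c1 * P - s1 * Q)); first by ring.
  by rewrite lin1 lin2 !mulr0 subrr.
have Q0 : Q = 0.
  apply: (mulfI det_neq0); rewrite mulr0.
  transitivity (c1 * (c2 * P - s2 * Q) - c2 * (c1 * P - s1 * Q)); first by ring.
  by rewrite lin1 lin2 !mulr0 subrr.
apply/eqP; rewrite eq_complex /=; apply/andP; split; apply/eqP.
  by move: P0; rewrite /P; lra.
by move: Q0; rewrite /Q; lra.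
Qed.

(** * The inner product and full spark *)

Lemma innerE (R : realType) (d : nat) (x y : 'cV[R[i]]_d) :
  inner x y = \sum_i x i 0 * (y i 0)^*%C.
Proof.
by rewrite /inner dotmxE !mxE; apply: eq_bigr => i _; rewrite !mxE.
Qed.

Lemma inner_sublZ (R : realType) (d : nat) (c : R[i]) (x y z : 'cV[R[i]]_d) :
  inner (x - c *: y) z = inner x z - c * inner y z.
Proof.
rewrite !innerE mulr_sumr -sumrB; apply: eq_bigr => i _.
by rewrite !mxE mulrBl mulrA.
Qed.

Lemma inner_addrZ (R : realType) (d : nat) (c : R[i]) (x y z : 'cV[R[i]]_d) :
  inner x (y + c *: z) = inner x y + c^*%C * inner x z.
Proof.
rewrite !innerE mulr_sumr -big_split; apply: eq_bigr => i _.
by rewrite !mxE rmorphD rmorphM /= mulrDr mulrCA.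
Qed.

Lemma inner_eq0 (R : realType) (d : nat) (x : 'cV[R[i]]_d) :
  inner x x = 0 -> x = 0.
Proof.
move=> xx0; apply/eqP; apply: contraTT isT => x_neq0.
have /dotmx_is_dotmx : x^T != 0 by rewrite -trmx0 (inj_eq trmx_inj).
by rewrite -/(inner x x) xx0 ltxx.
Qed.

Lemma inner_span_eq0 (R : realType) (d : nat) (X : seq 'cV[R[i]]_d)
    (x v : 'cV[R[i]]_d) :
  {in X, forall w, inner x w = 0} -> v \in <<X>>%VS -> inner x v = 0.
Proof.
move=> orthX; rewrite -[X]/(tval (in_tuple X)) => /coord_span ->.
have x0 : inner x 0 = 0.
  by rewrite innerE big1 // => i _; rewrite mxE conjc0 mulr0.
elim/big_ind: _ => [//|u w xu0 xw0|i _].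
- by rewrite -[w]scale1r inner_addrZ xu0 xw0 mulr0 addr0.
- rewrite -[X in inner x X]add0r inner_addrZ x0 add0r.
  by rewrite [inner x _]orthX ?mulr0 ?mem_nth.
Qed.

(** Any [d] of the vectors [f i] with [i] in [S] span the whole space, so [x]
    is orthogonal to itself. *)
Lemma full_spark_orthogonal (R : realType) (I : finType) (d : nat)
    (f : I -> 'cV[R[i]]_d) (S : {set I}) (x : 'cV[R[i]]_d) :
  full_spark f -> (d <= #|S|)%N -> {in S, forall i, inner x (f i) = 0} -> x = 0.
Proof.
move=> [_ spark] le_dS orthS; apply: inner_eq0.
(* [S] may have more than [d] elements: keep [d] of them. *)
pose T := [set i in take d (enum S)].
have cardT : #|T| = d.
  rewrite cardsE; have /card_uniqP -> : uniq (take d (enum S)).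
    by rewrite take_uniq ?enum_uniq.
  by rewrite size_takel // -cardE.
apply: (@inner_span_eq0 _ _ [seq f i | i in T]); last by rewrite spark ?memvf.
move=> _ /imageP[i iT ->]; apply: orthS.
by move: iT; rewrite inE => /mem_take; rewrite mem_enum.
Qed.

(** * The samples and the phase along a run *)

Lemma orbit_samplesE (R : realType) (d : nat) (A : 'M[R[i]]_d)
    (phi x : 'cV[R[i]]_d) (L : nat) (l : 'I_L) :
  orbit_samples A phi L x l = `|inner x (A ^+ l *m phi)|.
Proof. by rewrite ffunE. Qed.

Lemma interference_samplesE (R : realType) (d : nat) (A : 'M[R[i]]_d)
    (phi x : 'cV[R[i]]_d) (L : nat) (alpha : R) (l : 'I_L.-1) :
  interference_samples A phi L alpha x l =
  `|inner x (A ^+ l *m phi) + (expi alpha)^*%C * inner x (A ^+ l.+1 *m phi)|.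
Proof.
by rewrite ffunE mulmxDr -scalemxAr mulmxA -[A ^+ l *m A]/(A ^+ l * A)
  -exprSr inner_addrZ.
Qed.

Lemma samples_orbit (R : realType) (d : nat) (A : 'M[R[i]]_d)
    (phi x y : 'cV[R[i]]_d) (L : nat) (alpha1 alpha2 : R) (l : nat) :
  samples A phi L alpha1 alpha2 y = samples A phi L alpha1 alpha2 x ->
  (l < L)%N -> `|inner y (A ^+ l *m phi)| = `|inner x (A ^+ l *m phi)|.
Proof.
rewrite /samples => /pair_equal_spec[/pair_equal_spec[eq_orbit _] _] lt_l.
have orbitE z := orbit_samplesE A phi z (Ordinal lt_l).
by have := orbitE y; rewrite eq_orbit orbitE => /esym.
Qed.

Lemma samples_product (R : realType) (d : nat) (A : 'M[R[i]]_d)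
    (phi x y : 'cV[R[i]]_d) (L : nat) (alpha1 alpha2 : R) (l : nat) :
  ~ (exists m : int, alpha1 - alpha2 = m%:~R * pi) ->
  samples A phi L alpha1 alpha2 y = samples A phi L alpha1 alpha2 x ->
  (l.+1 < L)%N ->
  inner y (A ^+ l *m phi) * (inner y (A ^+ l.+1 *m phi))^*%C =
  inner x (A ^+ l *m phi) * (inner x (A ^+ l.+1 *m phi))^*%C.
Proof.
move=> nalpha eq_meas lt_l; have lt_l' : (l < L.-1)%N by rewrite ltn_predRL.
have eq_l := samples_orbit eq_meas (ltnW lt_l).
have eq_l1 := samples_orbit eq_meas lt_l.
move: eq_meas; rewrite /samples.
move=> /pair_equal_spec[/pair_equal_spec[_ eq_int1] eq_int2].
have intE alpha z :=
  interference_samplesE A phi z alpha (Ordinal lt_l').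
apply: (polarization2 nalpha eq_l eq_l1).
  by have := intE alpha1 y; rewrite eq_int1 intE => /esym.
by have := intE alpha2 y; rewrite eq_int2 intE => /esym.
Qed.

Lemma phase_propagation (R : realType) (a b : nat -> R[i]) (c : R[i])
    (t n : nat) :
  `|c| = 1 -> b t = c * a t ->
  (forall l, (t <= l < t + n)%N -> a l != 0) ->
  (forall l, (t <= l)%N -> (l.+1 < t + n)%N ->
     b l * (b l.+1)^*%C = a l * (a l.+1)^*%C) ->
  forall l, (t <= l < t + n)%N -> b l = c * a l.
Proof.
move=> norm_c bt a_neq0 prod_eq l /andP[]; elim: l => [|l IHl].
  by rewrite leqn0 => /eqP <-.
rewrite leq_eqVlt => /orP[/eqP <- // |].
rewrite ltnS => le_tl lt_l.
have bl := IHl le_tl (ltnW lt_l).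
have al_neq0 : a l != 0 by apply: a_neq0; rewrite le_tl ltnW.
have cc1 : c * c^*%C = 1 by rewrite -sqr_normc norm_c expr1n.
have := prod_eq l le_tl lt_l; rewrite bl mulrAC mulrC => eq_l.
have {eq_l} eq_l : c * (b l.+1)^*%C = (a l.+1)^*%C.
  by apply: (mulfI al_neq0); rewrite -eq_l; ring.
by rewrite -[a l.+1]conjcK -eq_l rmorphM /= conjcK mulrA cc1 mul1r.
Qed.

Unset Implicit Arguments.
Set Strict Implicit.

(** * Recovery up to a global phase *)

Theorem theorem5p3 (R : realType) (d L : nat) (A : 'M[R[i]]_d)
    (phi : 'cV[R[i]]_d) (alpha1 alpha2 : R)
    (h_spark : full_spark (orbit_family A phi L))
    (h_alpha : ~ exists m : int, alpha1 - alpha2 = m%:~R * pi)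
    (h_L : (d%:R ^+ 2 / 4 + d%:R / 2 : R) <= L%:R) :
  forall x : 'cV[R[i]]_d,
    recoverable_up_to_phase (samples A phi L alpha1 alpha2) x.
Proof.
move=> x y eq_meas.
pose a l := inner x (A ^+ l *m phi); pose b l := inner y (A ^+ l *m phi).
have norm_ab l : (l < L)%N -> `|b l| = `|a l|.
  exact: samples_orbit eq_meas.
have prod_ab l : (l.+1 < L)%N -> b l * (b l.+1)^*%C = a l * (a l.+1)^*%C.
  exact: samples_product h_alpha eq_meas.
have aE (l : 'I_L) : inner x (orbit_family A phi L l) = a l by [].
have bE (l : 'I_L) : inner y (orbit_family A phi L l) = b l by [].
(* The bodies of [a] and [b] are hidden to keep conversion tests cheap. *)
clearbody a b; clear eq_meas.
pose p l := a l == 0; pose z := count p (iota 0 L).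
have b_eq0 l : (l < L)%N -> p l -> b l = 0.
  by move=> lt_l /eqP al0; apply/eqP; rewrite -normr_eq0 norm_ab // al0 normr0.
have [le_dz | lt_zd] := leqP d z.
  have card_zeros : (d <= #|[set i : 'I_L | p i]|)%N by rewrite card_ord_count.
  have -> : x = 0.
    apply: (full_spark_orthogonal h_spark card_zeros) => i.
    by rewrite inE aE => /eqP.
  exists 0; rewrite scaler0.
  apply: (full_spark_orthogonal h_spark card_zeros) => i.
  by rewrite inE bE => p_i; apply: b_eq0.
have le_blocks := block_bound z h_L.
(* [z] zeros cannot meet all the [z + 1] blocks of length [d - z]. *)
have [|t /andP[_ le_t] no_zero] := @run_without p (d - z) z.+1 0.
  rewrite ltnS [leqRHS](_ : z = count p (iota 0 (z.+1 * (d - z))) +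
    count p (iota (0 + z.+1 * (d - z)) (L - z.+1 * (d - z))))%N ?leq_addr //.
  by rewrite -count_cat -iotaD subnKC.
rewrite add0n in le_t; have {le_t} le_t := leq_trans le_t le_blocks.
have a_neq0 l : (t <= l < t + (d - z))%N -> a l != 0.
  by move=> l_in; move/hasPn: no_zero => /(_ l); apply; rewrite mem_iota.
have t_in : (t <= t < t + (d - z))%N.
  by rewrite leqnn -[X in (X < _)%N]addn0 ltn_add2l subn_gt0.
have at_neq0 := a_neq0 t t_in.
have norm_c : `|b t / a t| = 1.
  rewrite normf_div norm_ab ?divff ?normr_eq0 //.
  by case/andP: t_in => _ /leq_trans; apply.
have [theta def_c] := expi_surj norm_c; exists theta.
(* [y - c *: x] is orthogonal to the [z] frame vectors at the zeros and to the
   [d - z] others of the run. *)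
apply/eqP; rewrite -def_c -subr_eq0; apply/eqP.
pose q l := p l || (t <= l < t + (d - z))%N.
apply: (full_spark_orthogonal (S := [set i : 'I_L | q i]) h_spark).
  rewrite (card_ord_count q); apply: leq_trans (count_add_run le_t no_zero).
  by rewrite -/z subnKC // ltnW.
move=> i; rewrite inE inner_sublZ aE bE.
case/orP => [p_i | i_in].
  by rewrite b_eq0 // (eqP p_i) mulr0 subrr.
apply/eqP; rewrite subr_eq0; apply/eqP.
apply: (phase_propagation norm_c _ a_neq0) i_in => [|l _ lt_l].
  by rewrite divfK.
by apply: prod_ab; exact: leq_trans lt_l le_t.
Qed.
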